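(* Let $X$ and $Y$ be two distinct points in the plane, and let $C_1$ and $C_2$ be two curves from $X$ to $Y$, both convex or both concave, which do not intersect except at $X$ and $Y$. Suppose that $C_1$ is contained inside the region bounded by $C_2$ and the chord $\overline{XY}$. Then $C_1$ is shorter than $C_2$, i.e. the arc-length of $C_1$ is strictly less than the arc-length of $C_2$.
   Context: A curve is (the graph of) a continuous function $f:[a,b]\to\mathbb{R}$ whose graph has a tangent line at every point of $[a,b]$ (one-sided at the endpoints; vertical tangents are not excluded); so $C_1,C_2$ are graphs of two such functions on the same interval $[a,b]$, $a<b$, with common values at $a$ and at $b$, both convex functions or both concave functions. The arc-length is the distance between the two endpoints along the curve, i.e. the length of the curve in the usual sense. *)

(* Defs.v *)
From HB Require Import structures.
From mathcomp Require Import all_boot all_order all_algebra.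
From mathcomp Require Import all_classical all_reals all_analysis.

Set Implicit Arguments.
Unset Strict Implicit.
Unset Printing Implicit Defensive.

Import Order.TTheory GRing.Theory Num.Theory.
Import numFieldTopology.Exports numFieldNormedType.Exports.

Local Open Scope classical_set_scope.
Local Open Scope ring_scope.

(* The built-in norm of R * R is the max norm, hence a separate definition. *)
Definition euclidean_dist (R : realType) (p q : R * R) : R :=
  Num.sqrt ((q.1 - p.1) ^+ 2 + (q.2 - p.2) ^+ 2).

Definition graph_on (R : realType) (a b : R) (f : R -> R) : set (R * R) :=
  [set p | p.1 \in `[a, b] /\ p.2 = f p.1].

Definition secant_slope (R : realType) (f : R -> R) (x y : R) : R :=
  (f y - f x) / (y - x).

(* The secant through (x, f x) and (y, f y) has a limiting position as y tends
   to x, y != x, within [a, b] (so one-sidedly if x = a or x = b): either a line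
   of finite slope l, or the vertical line. *)
Definition has_tangent_at (R : realType) (a b : R) (f : R -> R) (x : R) : Prop :=
  (exists l : R, secant_slope f x y @[y --> within `[a, b] x^'] --> l) \/
  (`|secant_slope f x y| @[y --> within `[a, b] x^'] --> +oo).

Definition curve_from_to (R : realType) (X Y : R * R) (f : R -> R) : Prop :=
  [/\ X.1 < Y.1,
      f X.1 = X.2,
      f Y.1 = Y.2,
      {within `[X.1, Y.1], continuous f} &
      forall x, x \in `[X.1, Y.1] -> has_tangent_at X.1 Y.1 f x].

Definition concave_function (R : realType) (D : set R) (f : R -> R) : Prop :=
  convex_function (D : set (convex_lmodType R^o)) (fun x => - f x).

Definition chord (R : realType) (X Y : R * R) (x : R) : R :=
  X.2 + (Y.2 - X.2) / (Y.1 - X.1) * (x - X.1).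

(* The region is closed: it contains the graph of f and the chord. *)
Definition chord_region (R : realType) (X Y : R * R) (f : R -> R) :
    set (R * R) :=
  [set p | p.1 \in `[X.1, Y.1] /\
    Num.min (f p.1) (chord X Y p.1) <= p.2
      <= Num.max (f p.1) (chord X Y p.1)].

(* As for itv_partition, s lists the subdivision points after a, the last one
   being b. *)
Definition polygonal_length (R : realType) (a b : R) (f : R -> R) (s : seq R)
    : R :=
  let P n := (nth b (a :: s) n, f (nth b (a :: s) n)) in
  \sum_(0 <= n < size s) euclidean_dist (P n) (P n.+1).

Definition arc_length (R : realType) (a b : R) (f : R -> R) : \bar R :=
  ereal_sup [set (polygonal_length a b f s)%:E | s in itv_partition a b].

(* Main.v *)
(** Let f <= g be concave with equal end values and D := g - f.  On an edge of
    width h where the secant slopes are p and q, convexity of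
    phi p := sqrt (1 + p^2) gives h phi(q) - h phi(p) >= phi'(p) * (increment of D).
    As p decreases along the subdivision and D >= 0 vanishes at both ends, Abel
    summation makes the sum of the right-hand sides nonnegative.  To get a gap
    uniform in the subdivision, choose interior points d < c with D(d) < D(c) and
    insert them as nodes: the slopes on [d, c] are bounded, so strong convexity of
    phi adds k h (q - p)^2 >= k (2 e h (q - p) - e^2 h), which telescopes on [d, c]
    to k (D(c) - D(d))^2 / (c - d) for the best choice of e.  Convex functions are
    handled by negation. *)
Require Import Defs.
From mathcomp Require Import all_boot all_order all_algebra.
From mathcomp Require Import all_classical all_reals all_analysis.
From mathcomp Require Import ring lra.

Set Implicit Arguments.
Unset Strict Implicit.
Unset Printing Implicit Defensive.

Import Order.TTheory GRing.Theory Num.Theory.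
Import numFieldTopology.Exports numFieldNormedType.Exports.

Local Open Scope classical_set_scope.
Local Open Scope ring_scope.

(** * Convexity of the length of a unit-width edge as a function of its slope *)

Definition phi (R : realType) (p : R) : R := Num.sqrt (1 + p ^+ 2).

(** The derivative of [phi], in closed form. *)
Definition dphi (R : realType) (p : R) : R := p / phi p.

Lemma phi_sqr (R : realType) (p : R) : phi p ^+ 2 = 1 + p ^+ 2.
Proof. by rewrite sqr_sqrtr// addr_ge0// sqr_ge0. Qed.

Lemma phi_gt0 (R : realType) (p : R) : 0 < phi p.
Proof. by rewrite sqrtr_gt0 ltr_pwDl// sqr_ge0. Qed.

Lemma dphi_geN1 (R : realType) (p : R) : -1 <= dphi p.
Proof.
rewrite ler_pdivlMr ?phi_gt0// mulN1r lerNl; apply: le_trans (ler_norm _) _.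
by rewrite normrN -sqrtr_sqr ler_wsqrtr// lerDr.
Qed.

Lemma dphi_le1 (R : realType) (p : R) : dphi p <= 1.
Proof.
by have := dphi_geN1 (- p); rewrite /dphi /phi sqrrN mulNr lerN2.
Qed.

(** With A = [phi p] and B = [phi q], multiplying by A turns the linear part into S = 1 + p q and
    the right-hand side into T = A B. The quadratic term comes from T^2 = S^2 + (q - p)^2. *)
Lemma phi_strongly_convex (R : realType) (M p q : R) :
  `|p| <= M -> `|q| <= M ->
  phi p + dphi p * (q - p) + (2 * phi M ^+ 3)^-1 * (q - p) ^+ 2 <= phi q.
Proof.
have phi_le r : `|r| <= M -> phi r <= phi M.
  move=> rM; rewrite ler_wsqrtr// lerD2l -(real_normK (num_real r)).
  by rewrite ler_sqr ?nnegrE// (le_trans _ rM).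
move=> /phi_le pM /phi_le qM; rewrite /dphi.
have [p2 q2] := (phi_sqr p, phi_sqr q).
have [p0 q0 M0] := And3 (phi_gt0 p) (phi_gt0 q) (phi_gt0 M).
move: (phi p) (phi q) (phi M) p2 q2 p0 q0 M0 pM qM => A B N A2 B2 A0 B0 N0 AN BN.
pose T := A * B; pose S := 1 + p * q.
have T0 : 0 < T by rewrite mulr_gt0.
have TS : T ^+ 2 = S ^+ 2 + (q - p) ^+ 2.
  by rewrite /T /S exprMn A2 B2; ring.
(* 2 T (T - S) exceeds T^2 - S^2 by the square (T - S)^2. *)
have H1 : S + (2 * T)^-1 * (q - p) ^+ 2 <= T.
  rewrite -lerBrDl mulrC ler_pdivrMr ?mulr_gt0//.
  have -> : (q - p) ^+ 2 = T ^+ 2 - S ^+ 2 by rewrite TS; ring.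
  by have := sqr_ge0 (T - S); nra.
(* The cube in the constant comes from A^2 B <= N^3. *)
have H2 : A * (2 * N ^+ 3)^-1 <= (2 * T)^-1.
  rewrite ler_pdivrMr ?mulr_gt0 ?exprn_gt0// ler_pdivlMl ?mulr_gt0//.
  rewrite /T.
  have : A * B * A <= N * N * N by rewrite !ler_pM ?mulr_ge0// ltW.
  by lra.
rewrite -(ler_pM2l A0).
have -> : A * (A + p / A * (q - p) + (2 * N ^+ 3)^-1 * (q - p) ^+ 2)
   = S + A * (2 * N ^+ 3)^-1 * (q - p) ^+ 2.
  have pA : A * (p / A) = p by rewrite mulrCA divff ?mulr1 ?gt_eqF.
  rewrite [LHS](_ : _ = A ^+ 2 + A * (p / A) * (q - p) +
    A * (2 * N ^+ 3)^-1 * (q - p) ^+ 2); last by ring.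
  by rewrite A2 pA /S; ring.
by apply: le_trans H1; rewrite lerD2l ler_wpM2r// sqr_ge0.
Qed.

Lemma phi_convex (R : realType) (p q : R) : phi p + dphi p * (q - p) <= phi q.
Proof.
have pM : `|p| <= `|p| + `|q| by rewrite lerDl.
have qM : `|q| <= `|p| + `|q| by rewrite lerDr.
apply: le_trans (phi_strongly_convex pM qM); rewrite lerDl mulr_ge0 ?sqr_ge0//.
by rewrite invr_ge0 mulr_ge0// exprn_ge0// ltW ?phi_gt0.
Qed.

(** Adding the supporting-line inequalities at [p] and at [q] gives (dphi p - dphi q)(q - p) <=
    0. *)
Lemma dphi_nondecreasing (R : realType) (p q : R) : p <= q -> dphi p <= dphi q.
Proof.
move=> pq; rewrite leNgt; apply/negP => qp.
have := phi_convex p q; have := phi_convex q p.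
have : p != q by apply: contraTneq qp => ->; rewrite ltxx.
move=> neq; have {}pq : p < q by rewrite lt_neqAle neq.
have : 0 < (dphi p - dphi q) * (q - p) by rewrite mulr_gt0// subr_gt0.
by lra.
Qed.

(** * Lengths of edges and of polygonal lines *)

Lemma euclidean_dist_secant (R : realType) (f : R -> R) (x y : R) : x < y ->
  euclidean_dist (x, f x) (y, f y) = (y - x) * phi (secant_slope f x y).
Proof.
rewrite -subr_gt0 /euclidean_dist /phi /secant_slope /= => h0.
rewrite -{2}[y - x]gtr0_norm// -sqrtr_sqr -sqrtrM ?sqr_ge0//; congr Num.sqrt.
by rewrite mulrDr mulr1 -exprMn mulrCA divff ?gt_eqF// mulr1.
Qed.

Lemma secant_slopeK (R : realType) (f : R -> R) (x y : R) : x < y ->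
  (y - x) * secant_slope f x y = f y - f x.
Proof.
by rewrite -subr_gt0 => h0; rewrite mulrCA divff ?gt_eqF// mulr1.
Qed.

(** Jensen's inequality for [phi]: the slope r of the long edge is the weighted mean of the slopes p
    and q of the short ones, so the linear terms of the supporting line at r cancel. *)
Lemma euclidean_dist_triangle (R : realType) (f : R -> R) (x c y : R) :
  x < c -> c < y ->
  euclidean_dist (x, f x) (y, f y) <=
  euclidean_dist (x, f x) (c, f c) + euclidean_dist (c, f c) (y, f y).
Proof.
move=> xc cy; have xy := lt_trans xc cy.
rewrite !euclidean_dist_secant//.
have [E E1 E2] := And3 (secant_slopeK f xy) (secant_slopeK f xc) (secant_slopeK f cy).
move: (secant_slope f x y) (secant_slope f x c) (secant_slope f c y) E E1 E2.
move=> r p q E E1 E2.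
have h1 : 0 <= c - x by lra.
have h2 : 0 <= y - c by lra.
have := ler_wpM2l h1 (phi_convex r p); have := ler_wpM2l h2 (phi_convex r q).
suff : (c - x) * (dphi r * (p - r)) + (y - c) * (dphi r * (q - r)) = 0 by lra.
rewrite mulrCA [X in _ + X]mulrCA -mulrDr.
have -> : (c - x) * (p - r) + (y - c) * (q - r) =
          (c - x) * p + (y - c) * q - (y - x) * r by ring.
by rewrite E E1 E2; ring.
Qed.

Lemma polygonal_length_nil (R : realType) (a b : R) (f : R -> R) :
  polygonal_length a b f [::] = 0.
Proof. by rewrite /polygonal_length big_geq. Qed.

Lemma polygonal_length_cons (R : realType) (a b : R) (f : R -> R) y s :
  polygonal_length a b f (y :: s) =
  euclidean_dist (a, f a) (y, f y) + polygonal_length y b f s.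
Proof. by rewrite /polygonal_length /= big_nat_recl. Qed.

(** * Insertion of a node into a subdivision *)

(** Taken relative to [e] so that the conditions for two points can be stacked. *)
Definition edge_avoiding (R : realType) (c : R) (e : rel R) : rel R :=
  [rel u v | e u v && ((v <= c) || (c <= u))].

(** At most one edge straddles [c]; it is cut there, and the triangle inequality applies. The
    splitting hypothesis keeps both halves in [e], so that an earlier insertion survives a later
    one. *)
Lemma polygonal_length_refine (R : realType) (f : R -> R) (c b : R) (e : rel R) :
  (forall u v, e u v -> u < v) ->
  (forall u v, e u v -> u < c < v -> e u c && e c v) ->
  forall s x, path e x s ->
  exists t, [/\ path (edge_avoiding c e) x t, last x t = last x s &
    polygonal_length x b f s <= polygonal_length x b f t].
Proof.
move=> elt esplit.
have right_part s x : c <= x -> path e x s -> path (edge_avoiding c e) x s.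
  elim: s x => //= y s IH x cx /andP[xy ys].
  rewrite {1}/edge_avoiding/= xy cx orbT/= IH//.
  by rewrite (le_trans cx)// ltW// elt.
elim=> [|y s IH] x /=; first by exists [::].
move=> /andP[xy ys]; have [cx|xc] := leP c x.
  by exists (y :: s); split => //; apply: right_part => //=; rewrite xy.
have [yc|cy] := leP y c.
  have [t [pt lt le]] := IH _ ys.
  exists (y :: t); split => //=; first by rewrite {1}/edge_avoiding/= xy yc.
  by rewrite !polygonal_length_cons lerD2l.
have /andP[xc' cy'] := esplit _ _ xy (introT andP (conj xc cy)).
exists (c :: y :: s); split => //=.
  by rewrite {1 2}/edge_avoiding/= xc' cy' !lexx orbT/= right_part// ltW.
by rewrite !polygonal_length_cons addrA lerD2r euclidean_dist_triangle.
Qed.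

(** * Comparison of two polygonal lengths on one subdivision *)

Definition decreasing_slopes (R : realType) (a b : R) (f : R -> R) :=
  forall x y z, a <= x -> x < y -> y < z -> z <= b ->
    secant_slope f y z <= secant_slope f x y.

(* Abel summation by induction on the subdivision: [K] stands for the boundary
   term [dphi p * (g x - f x)], [p] being the slope of the edge before [x]. *)
Lemma polygonal_length_comparison (R : realType) (a b : R) (f g F : R -> R)
    (e : rel R) :
  decreasing_slopes a b f ->
  (forall x, a <= x <= b -> f x <= g x) ->
  (forall x y, e x y -> x < y) ->
  (forall x y, a <= x -> y <= b -> e x y ->
    dphi (secant_slope f x y) * ((g y - f y) - (g x - f x)) + (F y - F x) <=
    euclidean_dist (x, g x) (y, g y) - euclidean_dist (x, f x) (y, f y)) ->
  forall s x K, a <= x -> path e x s -> last x s = b ->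
  (forall y, x < y <= b -> dphi (secant_slope f x y) * (g x - f x) <= K) ->
  - (g x - f x) <= K ->
  F b - F x - (g b - f b) <=
  polygonal_length x b g s - polygonal_length x b f s + K.
Proof.
move=> fconc fg elt edge.
have path_le s x : path e x s -> x <= last x s.
  elim: s x => //= y s IH x /andP[/elt xy /IH]; exact/le_trans/ltW.
elim=> [|y s IH] x K ax /=.
  by move=> _ -> _ K0; rewrite !polygonal_length_nil; lra.
move=> /andP[xy ys] lb HK _.
have yb : y <= b by rewrite -lb path_le.
have lxy := elt _ _ xy; have {edge} := edge _ _ ax yb xy.
have ay : a <= y by lra.
set p := secant_slope f x y =>  edge.
have Dy : 0 <= g y - f y by rewrite subr_ge0 fg// ay.
(* Edges after [y] have slope at most [p], so the boundary term at [y] can serve as the next [K]. *)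
have HK' : forall z, y < z <= b ->
    dphi (secant_slope f y z) * (g y - f y) <= dphi p * (g y - f y).
  move=> z /andP[yz zb]; rewrite ler_wpM2r// dphi_nondecreasing// fconc//.
(* This covers the case where the subdivision ends at [y] and no later edge bounds [K] from
   below. *)
have HK2 : - (g y - f y) <= dphi p * (g y - f y).
  by rewrite -mulN1r ler_wpM2r// dphi_geN1.
have := IH _ _ ay ys lb HK' HK2.
have := HK y; rewrite lxy yb => /(_ isT); rewrite -/p !polygonal_length_cons.
by lra.
Qed.

(** * Secant slopes of concave functions *)

Lemma concave_decreasing_slopes (R : realType) (a b : R) (f : R -> R) :
  concave_function `[a, b] f -> decreasing_slopes a b f.
Proof.
move=> fconc x y z ax xy yz zb.
(* The weight t = (z - y) / (z - x) is the one with y = t x + (1 - t) z. *)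
have t0 : 0 <= (z - y) / (z - x) by rewrite divr_ge0; lra.
have t1 : (z - y) / (z - x) <= 1 by rewrite ler_pdivrMr; lra.
have xab : x \in (`[a, b]%classic : set R) by rewrite inE/= in_itv/=; lra.
have zab : z \in (`[a, b]%classic : set R) by rewrite inE/= in_itv/=; lra.
have := fconc (Itv01 t0 t1) x z xab zab; rewrite !convRE/=.
have zx : z - x != 0 by rewrite gt_eqF// subr_gt0 (lt_trans xy).
have -> : conv (Itv01 t0 t1) (x : convex_lmodType R^o) z = y.
  transitivity ((z - y) / (z - x) * x + (1 - (z - y) / (z - x)) * z) => //.
  by field.
rewrite -(ler_pM2l (_ : 0 < z - x)); last by lra.
rewrite [X in _ <= X](_ : _ = - ((z - y) * f x + (y - x) * f z)); last first.
  transitivity ((z - x) * ((z - y) / (z - x) * - f x +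
    (1 - (z - y) / (z - x)) * - f z)) => //.
  by field.
move=> H; rewrite /secant_slope ler_pdivrMr; last by lra.
by rewrite mulrAC ler_pdivlMr; lra.
Qed.

Lemma decreasing_slopes_chord (R : realType) (X Y : R * R) (f : R -> R) (x : R) :
  decreasing_slopes X.1 Y.1 f -> f X.1 = X.2 -> f Y.1 = Y.2 ->
  X.1 <= x <= Y.1 -> X.1 < Y.1 -> chord X Y x <= f x.
Proof.
move=> fconc fX fY /andP[]; rewrite /chord.
rewrite le_eqVlt => /predU1P[<- _ _|Xx]; first by rewrite subrr mulr0 addr0 fX.
rewrite le_eqVlt => /predU1P[->XY|xY XY].
  by rewrite divfK ?gt_eqF ?subr_gt0// fY; lra.
have := fconc _ _ _ (lexx _) Xx xY (lexx _).
rewrite /secant_slope ler_pdivrMr; last by lra.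
rewrite mulrAC ler_pdivlMr; last by lra.
rewrite -lerBrDl mulrAC ler_pdivrMr; last by lra.
by rewrite fX fY; lra.
Qed.

(** Monotonicity traps these slopes between those over [d, b] and [a, c]. The margins matter: at a
    vertical end tangent slopes are unbounded. *)
Lemma decreasing_slopes_bounded (R : realType) (a c d b : R) (f : R -> R) :
  decreasing_slopes a b f -> a < c -> c < d -> d < b ->
  exists M, forall x y, c <= x -> x < y -> y <= d -> `|secant_slope f x y| <= M.
Proof.
move=> fconc ac cd db; pose P := secant_slope f a c; pose Q := secant_slope f d b.
exists (`|P| + `|Q|) => x y cx xy yd; rewrite ler_norml.
have -> : secant_slope f x y <= `|P| + `|Q|.
  suff : secant_slope f x y <= P by have := ler_norm P; have := normr_ge0 Q; lra.
  move: cx; rewrite le_eqVlt => /predU1P[cx|cx].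
    by rewrite -cx; apply: fconc; lra.
  by apply: (@le_trans _ _ (secant_slope f c x)); apply: fconc; lra.
rewrite andbT.
suff : Q <= secant_slope f x y.
  by have := ler_norm (- Q); rewrite normrN; have := normr_ge0 P; lra.
move: yd; rewrite le_eqVlt => /predU1P[yd|yd].
  by rewrite yd; apply: fconc; lra.
by apply: (@le_trans _ _ (secant_slope f y d)); apply: fconc; lra.
Qed.

(** * Edge estimates and boundedness of polygonal lengths *)

Lemma polygonal_length_cst (R : realType) (M b x : R) (s : seq R) :
  path <%R x s -> last x s = b -> polygonal_length x b (cst M) s = b - x.
Proof.
elim: s x => /= [x _ ->|y s IH x /andP[xy ys] lb].
  by rewrite polygonal_length_nil subrr.
rewrite polygonal_length_cons IH// /euclidean_dist/= subrr expr0n addr0 sqrtr_sqr.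
by rewrite gtr0_norm ?subr_gt0//; lra.
Qed.

(** Expanding k h (q - p - e)^2 >= 0, with h = y - x, trades the quadratic gain for terms linear in
    increments, which telescope. *)
Lemma euclidean_dist_secant_sub (R : realType) (f g : R -> R) (x y e k : R) :
  x < y ->
  (forall p q, p = secant_slope f x y -> q = secant_slope g x y ->
    phi p + dphi p * (q - p) + k * (q - p) ^+ 2 <= phi q) ->
  0 <= k ->
  dphi (secant_slope f x y) * ((g y - f y) - (g x - f x)) +
  k * (2 * e * ((g y - f y) - (g x - f x)) - e ^+ 2 * (y - x)) <=
  euclidean_dist (x, g x) (y, g y) - euclidean_dist (x, f x) (y, f y).
Proof.
move=> xy /(_ _ _ erefl erefl) H k0; rewrite !euclidean_dist_secant//.
have h0 : 0 <= y - x by lra.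
have := ler_wpM2l h0 H.
have -> : g y - f y - (g x - f x) =
    (y - x) * (secant_slope g x y - secant_slope f x y).
  by rewrite mulrBr !secant_slopeK//; ring.
set q := secant_slope g x y; set p := secant_slope f x y.
have : 0 <= k * ((y - x) * (q - p - e) ^+ 2).
  exact: mulr_ge0 k0 (mulr_ge0 h0 (sqr_ge0 _)).
by lra.
Qed.

Lemma euclidean_dist_secant_ge (R : realType) (f g : R -> R) (x y : R) :
  x < y ->
  dphi (secant_slope f x y) * ((g y - f y) - (g x - f x)) <=
  euclidean_dist (x, g x) (y, g y) - euclidean_dist (x, f x) (y, f y).
Proof.
move=> xy; have := @euclidean_dist_secant_sub R f g x y 0 0 xy.
rewrite mul0r addr0; apply => // p q _ _; rewrite mul0r addr0.
exact: phi_convex.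
Qed.

(* [f] is compared with the constant [M], whose polygonal lengths are [b - a]; the
   last two terms come from the end values of [M - f], as [`|dphi| <= 1]. *)
Lemma concave_polygonal_length_bounded (R : realType) (a b M : R) (f : R -> R) :
  decreasing_slopes a b f -> (forall x, a <= x <= b -> f x <= M) -> a <= b ->
  forall s, itv_partition a b s ->
  polygonal_length a b f s <= (b - a) + (M - f a) + (M - f b).
Proof.
move=> fconc fM ab s [ps /eqP lb].
have D0 : 0 <= M - f a by rewrite subr_ge0 fM// lexx.
suff : 0 - 0 - (M - f b) <=
    polygonal_length a b (cst M) s - polygonal_length a b f s + (M - f a).
  by rewrite (polygonal_length_cst _ ps lb); lra.
apply: (@polygonal_length_comparison R a b f (cst M) (cst 0) <%R) => //.
- by move=> x y _ _ xy; rewrite subrr addr0; exact: euclidean_dist_secant_ge.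
- by move=> y _; rewrite -[leRHS]mul1r ler_wpM2r// dphi_le1.
- by rewrite /=; lra.
Qed.

(** * A length gap uniform in the subdivision *)

(** Projection onto [c, d] when c <= d; it confines the gain to that interval. *)
Definition clamp (R : realType) (c d x : R) : R := Num.max c (Num.min d x).

Lemma concave_polygonal_length_gap (R : realType) (a b c d : R) (f g : R -> R) :
  a < d -> d < c -> c < b ->
  decreasing_slopes a b f -> decreasing_slopes a b g ->
  (forall x, a <= x <= b -> f x <= g x) ->
  f a = g a -> f b = g b -> g d - f d < g c - f c ->
  exists2 gap, 0 < gap & forall s, itv_partition a b s ->
    exists2 t, itv_partition a b t &
      polygonal_length a b f s + gap <= polygonal_length a b g t.
Proof.
move=> ad dc cb fconc gconc fg fga fgb Ddc.
have [Mf HMf] := decreasing_slopes_bounded fconc ad dc cb.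
have [Mg HMg] := decreasing_slopes_bounded gconc ad dc cb.
pose M := Num.max Mf Mg.
pose k := (2 * phi M ^+ 3)^-1.
have k0 : 0 < k by rewrite invr_gt0 mulr_gt0// exprn_gt0// phi_gt0.
pose D x := g x - f x.
(* The mean slope of [D] on [d, c] maximises 2 e (D c - D d) - e^2 (c - d). *)
pose e := (D c - D d) / (c - d).
(* The gain accumulated up to [x], constant to the left of [d] and to the right of [c]. *)
pose F x := k * (2 * e * D (clamp d c x) - e ^+ 2 * clamp d c x).
have cl_lo x : x <= d -> clamp d c x = d.
  move=> xd; rewrite /clamp min_r; last by lra.
  by rewrite max_l.
have cl_hi x : c <= x -> clamp d c x = c.
  move=> cx; rewrite /clamp min_l// max_r//; lra.
have cl_in x : d <= x <= c -> clamp d c x = x.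
  by move=> /andP[dx xc]; rewrite /clamp min_r// max_r.
have FE : F b - F a = k * ((D c - D d) ^+ 2 / (c - d)).
  rewrite /F cl_hi ?ltW// cl_lo ?ltW// /e.
  by field; rewrite subr_eq0 gt_eqF.
exists (F b - F a).
  by rewrite FE mulr_gt0// divr_gt0 ?subr_gt0// exprn_gt0// subr_gt0.
move=> s [ps /eqP lb].
have split_lt u v : u < v -> u < d < v -> (u < d) && (d < v) by [].
(* An edge across [c] that avoids [d] starts at or after [d], hence so do both halves. *)
have split_edge u v : edge_avoiding d <%R u v -> u < c < v ->
    edge_avoiding d <%R u c && edge_avoiding d <%R c v.
  move=> /andP[uv udv] /andP[uc cv]; rewrite /edge_avoiding/= uc cv/=.
  by lra.
have [t1 [pt1 lt1 le1]] :=
  polygonal_length_refine f b (fun u v uv => uv) split_lt ps.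
have [t [pt lt le2]] := polygonal_length_refine f b
  (fun u v (uv : edge_avoiding d <%R u v) => proj1 (andP uv)) split_edge pt1.
have edge_lt u v : edge_avoiding c (edge_avoiding d <%R) u v -> u < v.
  by move=> /andP[/andP[]].
have tb : last a t = b by rewrite lt lt1.
exists t; first by split; [exact: sub_path edge_lt _ _ pt|rewrite tb].
have Da : g a - f a = 0 by rewrite fga subrr.
suff : F b - F a - (g b - f b) <=
    polygonal_length a b g t - polygonal_length a b f t + 0 by rewrite fgb; lra.
apply: (polygonal_length_comparison fconc fg edge_lt _ _ pt tb) => //; last first.
- by rewrite Da oppr0.
- by move=> y _; rewrite Da mulr0.
move=> x y ax yb exy; have xy := edge_lt _ _ exy.
have outside : F y = F x -> dphi (secant_slope f x y) * (g y - f y - (g x - f x)) +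
    (F y - F x) <=
    euclidean_dist (x, g x) (y, g y) - euclidean_dist (x, f x) (y, f y).
  by move=> ->; rewrite subrr addr0; exact: euclidean_dist_secant_ge.
(* Each edge lies left of [d], within [d, c] or right of [c]; the remaining combination contradicts
   d < c. *)
move: exy => /andP[/andP[_ /orP[yd|dx]] /orP[yc|cx]].
- by apply: outside; rewrite /F !cl_lo//; lra.
- by lra.
- have [yc' xc] : (d <= y) /\ (x <= c) by lra.
  have -> : F y - F x =
      k * (2 * e * ((g y - f y) - (g x - f x)) - e ^+ 2 * (y - x)).
    by rewrite /F !cl_in ?dx ?xc ?yc ?yc'// /D; ring.
  apply: euclidean_dist_secant_sub => //; last exact: ltW.
  by move=> p q -> ->; apply: phi_strongly_convex;
    rewrite /M le_max ?HMf ?HMg ?orbT.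
- by apply: outside; rewrite /F !cl_hi//; lra.
Qed.

(** * Strict inequality of arc lengths in the concave case *)

Lemma concave_arc_length_lt (R : realType) (a b c : R) (f g : R -> R) :
  a < c -> c < b ->
  decreasing_slopes a b f -> decreasing_slopes a b g ->
  {within `[a, b], continuous f} -> {within `[a, b], continuous g} ->
  (forall x, a <= x <= b -> f x <= g x) ->
  f a = g a -> f b = g b -> f c < g c ->
  (arc_length a b f < arc_length a b g)%E.
Proof.
move=> ac cb fconc gconc fcont gcont fg fga fgb fgc.
have ab := lt_trans ac cb.
(* Half the value at [c] differs from the values of g - f at both [a] and [c], so [d] is strictly
   between them. *)
have [d dac Dd] : exists2 d, d \in `[a, c] & g d - f d = (g c - f c) / 2.
  apply: (@IVT _ (fun x => g x - f x)); first exact: ltW.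
    apply: (@continuous_subspaceW _ _ `[a, c]%classic `[a, b]%classic).
      by apply: subset_itvl; rewrite bnd_simp ltW.
    by move=> x; apply: cvgB; [exact: gcont|exact: fcont].
  rewrite fga subrr ge_min le_max; apply/andP; split; apply/orP; lra.
move: dac; rewrite in_itv/= => /andP[ad dc].
have {}ad : a < d.
  by rewrite lt_neqAle ad andbT; apply/eqP => ad'; move: Dd; rewrite -ad' fga; lra.
have {}dc : d < c.
  by rewrite lt_neqAle dc andbT; apply/eqP => dc'; move: Dd; rewrite dc'; lra.
have Ddc : g d - f d < g c - f c by lra.
have [gap gap0 Hgap] :=
  concave_polygonal_length_gap ad dc cb fconc gconc fg fga fgb Ddc.
have [m _ fm] := EVT_max (ltW ab) fcont.
have fM x : a <= x <= b -> f x <= f m by move=> xab; rewrite fm// in_itv.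
(* Finiteness makes adding [gap] a strict increase. *)
have ffin : arc_length a b f \is a fin_num.
  rewrite fin_numE; apply/andP; split.
    rewrite gt_eqF// (@lt_le_trans _ _ (polygonal_length a b f [:: b])%:E) ?ltNyr//.
    by apply: ereal_sup_ubound; exists [:: b] => //; exact: itv_partition1.
  rewrite -ltey; apply: le_lt_trans (ltry (b - a + (f m - f a) + (f m - f b))).
  apply: ge_ereal_sup => _ [s ps <-]; rewrite lee_fin.
  exact: concave_polygonal_length_bounded (ltW ab) _ ps.
apply: (@lt_le_trans _ _ (arc_length a b f + gap%:E)%E).
  by rewrite lteDl.
rewrite -leeBrDr//; apply: ge_ereal_sup => _ [s ps <-].
have [t pt le] := Hgap s ps; rewrite leeBrDr// -EFinD.
apply: le_trans (_ : (polygonal_length a b g t)%:E <= _)%E; first by rewrite lee_fin.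
by apply: ereal_sup_ubound; exists t.
Qed.

(** * Reduction of the theorem to the concave case *)

Lemma arc_lengthN (R : realType) (a b : R) (f : R -> R) :
  arc_length a b (fun x => - f x) = arc_length a b f.
Proof.
rewrite /arc_length; congr ereal_sup; apply: eq_imagel => s _; congr EFin.
apply: eq_bigr => i _; rewrite /euclidean_dist/=; congr (Num.sqrt (_ + _)).
by rewrite -opprD sqrrN.
Qed.

(** A concave graph lies above its chord, so the upper boundary of the region is the graph of
    [f2]. *)
Lemma concave_region_le (R : realType) (X Y : R * R) (f1 f2 : R -> R) :
  decreasing_slopes X.1 Y.1 f2 -> f2 X.1 = X.2 -> f2 Y.1 = Y.2 -> X.1 < Y.1 ->
  graph_on X.1 Y.1 f1 `<=` chord_region X Y f2 ->
  forall x, X.1 <= x <= Y.1 -> f1 x <= f2 x.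
Proof.
move=> f2conc f2X f2Y XY hregion x xXY.
have [|_ /andP[_]] := hregion (x, f1 x); first by split => //=; rewrite in_itv.
by rewrite max_l// decreasing_slopes_chord.
Qed.

Theorem corollary5 (R : realType) (X Y : R * R) (hXY : X <> Y)
    (f1 f2 : R -> R)
    (hC1 : curve_from_to X Y f1) (hC2 : curve_from_to X Y f2)
    (hconv :
      (convex_function (`[X.1, Y.1] : set (convex_lmodType R^o)) f1 /\
       convex_function (`[X.1, Y.1] : set (convex_lmodType R^o)) f2) \/
      (concave_function `[X.1, Y.1] f1 /\ concave_function `[X.1, Y.1] f2))
    (hinter : graph_on X.1 Y.1 f1 `&` graph_on X.1 Y.1 f2 = [set X; Y])
    (hregion : graph_on X.1 Y.1 f1 `<=` chord_region X Y f2) :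
  (arc_length X.1 Y.1 f1 < arc_length X.1 Y.1 f2)%E.
Proof.
case: hC1 hC2 => XY f1X f1Y f1cont _ [_ f2X f2Y f2cont _].
(* An interior abscissa, where the graphs differ because they meet only at [X] and [Y]. *)
pose c := (X.1 + Y.1) / 2.
have Xc : X.1 < c by rewrite /c; lra.
have cY : c < Y.1 by rewrite /c; lra.
have neq : f1 c <> f2 c.
  move=> f12; have cXY : c \in `[X.1, Y.1] by rewrite in_itv/= !ltW.
  have : (graph_on X.1 Y.1 f1 `&` graph_on X.1 Y.1 f2) (c, f1 c) by split; split.
  by rewrite hinter => -[E|E]; move: Xc cY; rewrite -E/= ltxx.
case: hconv => [[conv1 conv2]|[conc1 conc2]].
  (* Reflection in the horizontal axis makes convex graphs concave and exchanges the two bounds of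
     the region. *)
  pose opp_snd (p : R * R) := (p.1, - p.2).
  have NK (f : R -> R) : (fun x => - - f x) = f by apply/funext => x; rewrite opprK.
  have slopes1 : decreasing_slopes X.1 Y.1 (fun x => - f1 x).
    by apply: concave_decreasing_slopes; rewrite /concave_function NK.
  have slopes2 : decreasing_slopes X.1 Y.1 (fun x => - f2 x).
    by apply: concave_decreasing_slopes; rewrite /concave_function NK.
  have le12 : forall x, X.1 <= x <= Y.1 -> - f1 x <= - f2 x.
    apply: (@concave_region_le _ (opp_snd X) (opp_snd Y)) => //=.
    - by rewrite f2X.
    - by rewrite f2Y.
    move=> [x y] [/= xXY ->].
    have [|_ /=] := hregion (x, f1 x); first by split.
    split => //=.
    have -> : chord (opp_snd X) (opp_snd Y) x = - chord X Y x.
      by rewrite /chord/=; ring.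
    by rewrite -oppr_max -oppr_min !lerN2 andbC.
  rewrite -(arc_lengthN _ _ f1) -(arc_lengthN _ _ f2).
  apply: (concave_arc_length_lt Xc cY slopes1 slopes2) => //.
  - by move=> x; apply: cvgN; exact: f1cont.
  - by move=> x; apply: cvgN; exact: f2cont.
  - by rewrite f1X f2X.
  - by rewrite f1Y f2Y.
  - by rewrite lt_neqAle le12 ?andbT ?(ltW Xc) ?(ltW cY)//; apply/eqP => /oppr_inj.
have slopes1 := concave_decreasing_slopes conc1.
have slopes2 := concave_decreasing_slopes conc2.
have le12 := concave_region_le slopes2 f2X f2Y XY hregion.
apply: (concave_arc_length_lt Xc cY slopes1 slopes2) => //.
- by rewrite f1X f2X.
- by rewrite f1Y f2Y.
- by rewrite lt_neqAle le12 ?andbT ?(ltW Xc) ?(ltW cY)//; exact/eqP.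
Qed.
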